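(* Let $k,s\ge 1$ be integers, let $n=2ks$, let $a\in\mathbb{R}$ and $b,c\in\mathbb{R}\setminus\{0\}$, and let $A_k$ be the $n\times n$ Toeplitz matrix with entries $(A_k)_{i,i}=a$, $(A_k)_{i,i+k}=b$, $(A_k)_{i+k,i}=c$, and all other entries $0$. Then the eigenvalues of $A_k$ are $$\lambda_r=a-2\sqrt{bc}\,\cos\left(\frac{kr\pi}{n+k}\right),\qquad r=1,2,\dots,\frac{n}{k},$$ and the eigenvectors of $A_k$ are the following column vectors $(P_k)_j$, $j=1,\dots,n$. For each $m\in\{1,\dots,k\}$ and each $j=m,\,m+k,\,m+2k,\dots,\,n-k+m$, put $r=\frac{j+k-m}{k}$; then $(P_k)_j$ is the vector whose entry in position $m+tk$ is $$\mu^{\frac{t}{2}}\,U_t(\alpha_r),\qquad t=0,1,\dots,\frac{n-k}{k},$$ and whose entries in all other positions are $0$. Here $\mu=\frac{c}{b}$ and $\alpha_r=\frac{\lambda_r-a}{2\sqrt{bc}}$, and the index $r$ attached to $(P_k)_j$ is that of the eigenvalue $\lambda_r$ to which it belongs.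
   Context: $U_t$ denotes the Chebyshev polynomial of the second kind of degree $t$, i.e. $U_t(x)=\frac{\sin((t+1)\arccos x)}{\sin(\arccos x)}$. Square roots of negative real numbers are complex numbers.
   Formalization: That (P_k)_j belongs to λ_r with r=(j+k-m)/k is asserted only when the square roots are chosen so that √μ·b=√(bc); with principal roots this fails for b<0 (e.g. k=s=1, a=0, b=c=-1, where P_1 belongs to λ_2). *)

(* Defs.v *)
From HB Require Import structures.
From mathcomp Require Import all_boot all_order all_algebra.
From mathcomp Require Import complex.
From mathcomp Require Import reals trigo ring.

Set Implicit Arguments.
Unset Strict Implicit.
Unset Printing Implicit Defensive.

Import Order.TTheory GRing.Theory Num.Theory.
Local Open Scope ring_scope.
Local Open Scope complex_scope.

(* Chebyshev polynomial of the second kind of degree [t], by its three-term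
   recurrence so that it can be evaluated at any point of any ring.
   [chebyshevU_acos] is the trigonometric formula on ]-1, 1[. *)
Fixpoint chebyshevU (F : nzRingType) (t : nat) : {poly F} :=
  match t with
  | 0 => 1
  | t1.+1 => match t1 with
             | 0 => 2%:R *: 'X
             | t2.+1 => 2%:R *: 'X * chebyshevU F t1 - chebyshevU F t2
             end
  end.

Lemma chebyshevU_recE (F : nzRingType) (t : nat) :
  chebyshevU F t.+2 = 2%:R *: 'X * chebyshevU F t.+1 - chebyshevU F t.
Proof. by []. Qed.

Lemma chebyshevU_sin (R : realType) (t : nat) (y : R) :
  (chebyshevU R t).[cos y] * sin y = sin (t.+1%:R * y).
Proof.
elim/ltn_ind: t => -[|[|t]] IH.
- by rewrite hornerC !mul1r.
- by rewrite hornerZ hornerX !mulr_natl mulr2n sinD mulrDl [cos y * _]mulrC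
     [sin y * _]mulrC.
rewrite chebyshevU_recE hornerD hornerN hornerM hornerZ hornerX.
rewrite mulrBl -!mulrA !IH //.
have -> : t.+3%:R * y = t.+2%:R * y + y by rewrite !mulr_natl [in LHS]mulrSr.
have -> : t.+1%:R * y = t.+2%:R * y - y.
  by rewrite !mulr_natl [in RHS]mulrSr addrK.
by move: (_%:R * y) => z; rewrite sinB sinD; ring.
Qed.

Lemma chebyshevU_acos (R : realType) (t : nat) (x : R) : -1 < x < 1 ->
  (chebyshevU R t).[x] = sin (t.+1%:R * acos x) / sin (acos x).
Proof.
move=> /andP[x1 x2].
have xI : x \in `[(-1), 1]%R by rewrite in_itv /= !ltW.
have s0 : sin (acos x) != 0.
  by rewrite gt_eqF // sin_gt0_pi // acos_gt0 ?acos_ltpi ?x1 ?x2 ?ltW.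
by rewrite -chebyshevU_sin acosK // mulfK.
Qed.

Lemma chebyshevU_complex (R : realType) (t : nat) (x : R) :
  (chebyshevU R[i] t).[x%:C] = (chebyshevU R t).[x]%:C.
Proof.
elim/ltn_ind: t => -[|[|t]] IH.
- by rewrite !hornerC.
- by rewrite !hornerZ !hornerX rmorphM /= rmorph_nat.
rewrite !chebyshevU_recE !(hornerD, hornerN, hornerM, hornerZ, hornerX) !IH //.
by rewrite rmorphB !rmorphM /= rmorph_nat.
Qed.

Definition toeplitz (F : nzRingType) (n k : nat) (a b c : F) : 'M[F]_n :=
  \matrix_(i < n, j < n)
    if j == i :> nat then a
    else if j == (i + k)%N :> nat then b
    else if i == (j + k)%N :> nat then c
    else 0.

(* Column eigenvectors; the library's [eigenspace] is about row vectors. *)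
Definition is_eigenvector (F : fieldType) (n : nat)
    (A : 'M[F]_n) (lam : F) (v : 'cV[F]_n) : Prop :=
  v != 0 /\ A *m v = lam *: v.

(* Below, [rbc] and [rmu] stand for the (possibly non-real) numbers
   sqrt(bc) and sqrt(c/b).  Any square roots are allowed, but they enter
   the eigenvectors through the relation sqrt(c/b) * b = sqrt(bc), which holds
   only up to sign in general (it fails for principal roots when b < 0); with
   the opposite sign, the vector indexed by r belongs to the eigenvalue
   of index n/k + 1 - r instead.  Matrix positions are numbered from 1, so that
   position [i.+1] is the row of index [i : 'I_n]. *)

Definition lambda (R : realType) (n k : nat) (a : R) (rbc : R[i]) (r : nat)
  : R[i] :=
  a%:C - 2%:R * rbc * (cos ((k * r)%:R * pi / (n + k)%:R))%:C.

Definition alpha (R : realType) (n k : nat) (a : R) (rbc : R[i]) (r : nat)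
  : R[i] :=
  (lambda n k a rbc r - a%:C) / (2%:R * rbc).

(* The unique [m] in {1, ..., k} such that [j] is one of m, m+k, m+2k, ... *)
Definition residue (k j : nat) : nat := (j.-1 %% k).+1.

Definition index_of (k j : nat) : nat := (j + k - residue k j) %/ k.

Lemma residueE (k m q : nat) : (1 <= m <= k)%N -> residue k (m + q * k) = m.
Proof.
by case: m => // m mk; rewrite /residue addSn /= addnC modnMDl modn_small.
Qed.

Lemma index_ofE (k m q : nat) : (1 <= m <= k)%N -> index_of k (m + q * k) = q.+1.
Proof.
move=> mk; rewrite /index_of residueE // -addnA addKn -mulSnr mulnK //.
by case: k mk => [|//]; case: m.
Qed.

Definition eigvec (R : realType) (n k : nat) (a : R) (rbc rmu : R[i]) (j : nat)
  : 'cV[R[i]]_n :=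
  let m := residue k j in
  \col_(i < n)
    if (m <= i.+1)%N && (k %| i.+1 - m)%N then
      let t := ((i.+1 - m) %/ k)%N in
      rmu ^+ t * (chebyshevU R[i] t).[alpha n k a rbc (index_of k j)]
    else 0.

(* Main.v *)
Require Import Defs.
From mathcomp Require Import all_boot all_order all_algebra.
From mathcomp Require Import complex.
From mathcomp Require Import reals trigo ring.

Import Order.TTheory GRing.Theory Num.Theory.
Local Open Scope ring_scope.
Local Open Scope complex_scope.

(** Write [N = n / k] and [x r = - cos (r pi / (N + 1))], so that the r-th
    eigenvalue is [a + 2 rbc (x r)] and the argument of the Chebyshev
    polynomials in the r-th eigenvectors is [x r].

    A vector supported on one residue class of positions modulo [k] is a
    sequence [w 0, ..., w (N - 1)], and on such vectors [A] acts as the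
    tridiagonal Toeplitz matrix of order [N].  For [w t = mu ^ t * U_t(x)] with
    [mu ^ 2 = c / b], the recurrence [U_(t+2) = 2 x U_(t+1) - U_t] is the
    eigenvector equation for [a + 2 mu b x]; the first row holds because
    [U_1 = 2 x U_0], and the last one holds exactly when [U_N(x) = 0]
    ([toeplitz_chebyshev]).  The [x r], for [1 <= r <= N], are roots of [U_N]
    by [U_N(cos y) sin y = sin ((N + 1) y)] ([chebyshevU_root]).

    Since [(mu b) ^ 2 = b c], the number [mu b] is [rbc] or [- rbc].  In the
    second case the eigenvalue of the vector of index [r] is
    [a - 2 rbc (x r)], which is the eigenvalue of index [N + 1 - r] because
    [x (N + 1 - r) = - x r].

    The vectors form a basis ([strided_basis]): the classes modulo [k] do not
    interact, and within one class a linear relation kills the values of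
    [U_0, ..., U_(N-1)] at the distinct points [x r]; these polynomials span
    all those of degree less than [N], in particular the products
    vanishing at all of the points but one.  An eigenbasis carries the whole
    spectrum ([eigenvalue_eigenbasis]), so there are no other eigenvalues. *)

(** * Eigenbases *)

(** [eigenvalue] is about row vectors and [X] consists of column vectors: a left
    eigenvector pairs nontrivially with some member of [X], which forces its
    eigenvalue. *)
Lemma eigenvalue_eigenbasis (F : fieldType) (n : nat) (A : 'M[F]_n)
    (X : n.-tuple 'cV[F]_n) (d : 'I_n -> F) (x : F) :
    basis_of fullv X -> (forall i : 'I_n, A *m X`_i = d i *: X`_i) ->
  eigenvalue A x <-> exists i, x = d i.
Proof.
move=> bX AX; split.
  move=> /eigenvalueP[v vA v0].
  have [i vXi] : exists i : 'I_n, v *m X`_i != 0.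
    apply/existsP; apply: contraNT v0; rewrite negb_exists => /forallP vX0.
    have vy0 (y : 'cV_n) : v *m y = 0.
      rewrite (coord_basis bX (memvf y)) mulmx_sumr big1 // => i _.
      by have := vX0 i; rewrite negbK -scalemxAr => /eqP->; rewrite scaler0.
    apply/eqP/rowP => j; rewrite !mxE.
    have := congr1 (fun M : 'M_1 => M 0 0) (vy0 (delta_mx j 0)).
    by rewrite -colE !mxE.
  exists i; apply/eqP; rewrite -subr_eq0; apply: contraNT vXi => dx.
  suff : (x - d i) *: (v *m X`_i) == 0 by rewrite scaler_eq0 (negPf dx).
  by rewrite scalerBl scalemxAl -vA -mulmxA AX scalemxAr subrr.
move=> [i ->]; rewrite /eigenvalue /eigenspace kermx_eq0 row_free_unit.
have Xi0 : X`_i != 0.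
  by apply: (free_not0 (basis_free bX)); rewrite mem_nth ?size_tuple.
apply: contraNN Xi0 => uA.
by rewrite -[X`_i](mulKmx uA) mulmxBl AX mul_scalar_mx subrr mulmx0.
Qed.

(** * Chebyshev polynomials and their roots *)

Lemma size_chebyshevU (F : numDomainType) (t : nat) :
  size (chebyshevU F t) = t.+1.
Proof.
elim/ltn_ind: t => -[|[|t]] IH.
- by rewrite size_poly1.
- by rewrite size_scale ?size_polyX // pnatr_eq0.
have sz : size (2%:R *: 'X * chebyshevU F t.+1) = t.+3.
  rewrite -scalerAl mulrC size_scale ?pnatr_eq0 // size_mulX ?IH //.
  by rewrite -size_poly_eq0 IH.
by rewrite chebyshevU_recE size_polyDl ?sz // size_polyN IH // ltnW.
Qed.

Lemma sin_natM_pi (R : realType) (m : nat) : sin (m%:R * pi) = 0 :> R.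
Proof.
elim: m => [|m IHm]; first by rewrite mul0r sin0.
by rewrite -natr1 mulrDl mul1r sinDpi IHm oppr0.
Qed.

(** The roots of the Chebyshev polynomial of the second kind of degree [N], in
    increasing order for [r = 1, ..., N]. *)
Definition cheb_root (R : realType) (N r : nat) : R :=
  - cos (r%:R * pi / N.+1%:R).

Lemma cheb_rootC (R : realType) (N r : nat) : (r <= N.+1)%N ->
  cheb_root R N (N.+1 - r) = - cheb_root R N r.
Proof.
move=> rN; rewrite /cheb_root opprK natrB // !mulrBl mulrAC divff ?pnatr_eq0 //.
by rewrite mul1r -cosN opprB cosB sinpi cospi mulr0 addr0 mulrN1 opprK.
Qed.

Lemma cheb_angle (R : realType) (N r : nat) : (r <= N.+1)%N ->
  r%:R * pi / N.+1%:R \in `[0, pi : R].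
Proof.
move=> rN; rewrite in_itv /= divr_ge0 ?mulr_ge0 ?pi_ge0 //=.
by rewrite ler_pdivrMr ?ltr0n // mulrC ler_pM2l ?pi_gt0 // ler_nat.
Qed.

Lemma cheb_root_inj (R : realType) (N : nat) :
  {in geq N.+1 &, injective (cheb_root R N)}.
Proof.
move=> r r' rN r'N /oppr_inj/cos_inj.
move=> /(_ (cheb_angle R _ _ rN) (cheb_angle R _ _ r'N)).
have piN : pi / N.+1%:R != 0 :> R.
  by rewrite mulf_neq0 ?invr_eq0 ?pnatr_eq0 // gt_eqF ?pi_gt0.
by rewrite -!mulrA => /(mulIf piN)/eqP; rewrite eqr_nat => /eqP.
Qed.

Lemma chebyshevU_root (R : realType) (N r : nat) : (1 <= r <= N)%N ->
  (chebyshevU R N).[cheb_root R N r] = 0.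
Proof.
move=> /andP[r1 rN].
(* [cheb_root R N r = cos y] with [y = (N + 1 - r) pi / (N + 1)]. *)
rewrite -[cheb_root R N r]opprK -cheb_rootC ?leqW // /cheb_root opprK.
set y := (X in cos X); have N0 : N.+1%:R != 0 :> R by rewrite pnatr_eq0.
have y0 : sin y != 0.
  rewrite gt_eqF // sin_gt0_pi // divr_gt0 ?mulr_gt0 ?pi_gt0 ?ltr0n //=.
    rewrite ltr_pdivrMr ?ltr0n // mulrC ltr_pM2l ?pi_gt0 // ltr_nat.
    by rewrite ltn_subrL r1.
  by rewrite subn_gt0 ltnS.
apply: (mulIf y0); rewrite chebyshevU_sin mul0r /y mulrC divfK //.
exact: sin_natM_pi.
Qed.

(** * Toeplitz matrices acting on strided vectors *)

(** The column vector with entry [w t] in the row of index [p + t * k] and 0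
    in the rows whose index is not congruent to [p] modulo [k]; rows are
    numbered from 0. *)
Definition strided (F : nmodType) (n k p : nat) (w : nat -> F) : 'cV[F]_n :=
  \col_(i < n) if (i %% k == p)%N then w (i %/ k)%N else 0.

Lemma strided_neq0 (F : nmodType) (n k p : nat) (w : nat -> F) :
  (p < k)%N -> (p < n)%N -> w 0%N != 0 -> strided F n k p w != 0.
Proof.
move=> pk pn; apply: contraNN => /eqP/colP/(_ (Ordinal pn)).
by rewrite !mxE /= modn_small // divn_small // eqxx => ->.
Qed.

Lemma sum_ord_eq (F : nmodType) (n m : nat) (g : nat -> F) :
  \sum_(j < n) (if j == m :> nat then g j else 0) = if (m < n)%N then g m else 0.
Proof.
case: ifPn => [mn|mn].
  rewrite (bigD1 (Ordinal mn)) //= eqxx big1 ?addr0 // => j.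
  by rewrite -val_eqE => /= /negPf->.
by rewrite big1 // => j _; case: eqP => // jm; rewrite -jm ltn_ord in mn.
Qed.

Lemma toeplitz_mul_col (F : nzRingType) (n k : nat) (a b c : F) (g : nat -> F)
    (i : 'I_n) : (0 < k)%N ->
  (toeplitz n k a b c *m \col_(j < n) g j) i 0 =
    a * g i + b * (if (i + k < n)%N then g (i + k)%N else 0)
            + c * (if (k <= i)%N then g (i - k)%N else 0).
Proof.
move=> k_gt0.
have sub_k : (if (k <= i)%N then g (i - k)%N else 0) =
    \sum_(j < n) (if i == (j + k)%N :> nat then g j else 0).
  case: (leqP k i) => ki.
    have ikn : (i - k < n)%N by rewrite (leq_ltn_trans (leq_subr _ _)).
    have := sum_ord_eq _ n (i - k) g; rewrite ikn => <-; apply: eq_bigr => j _.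
    by rewrite -[in RHS](subnK ki) eqn_add2r eq_sym.
  rewrite big1 // => j _; case: eqP => // ij.
  by rewrite ij ltnNge leq_addl in ki.
have g_i : g i = \sum_(j < n) (if j == i :> nat then g j else 0).
  by rewrite sum_ord_eq ltn_ord.
rewrite sub_k g_i -sum_ord_eq mxE !mulr_sumr -!big_split /=.
apply: eq_bigr => j _; rewrite !mxE.
have shift_neq m : (m == m + k)%N = false.
  by rewrite -[X in X == _]addn0 eqn_add2l eq_sym -[_ == _]negbK -lt0n k_gt0.
case: (eqVneq (j : nat) i) => [->|ji].
  by rewrite !shift_neq !mulr0 !addr0.
case: (eqVneq (j : nat) (i + k)%N) => [->|jik].
  rewrite -addnA -[X in X == (_ + _)%N]addn0 eqn_add2l eq_sym addn_eq0.
  by rewrite gtn_eqF // !mulr0 add0r addr0.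
by case: eqP => _; rewrite ?(mulr0, mul0r, add0r).
Qed.

(** On strided vectors the matrix acts as a tridiagonal Toeplitz matrix of order
    [N], whose eigenvector equation is a three-term recurrence with boundary
    conditions [w (-1) = 0] (built into the first equation) and [w N = 0]. *)
Lemma toeplitz_strided (F : comNzRingType) (N k p : nat) (a b c x : F)
    (w : nat -> F) :
    (0 < k)%N ->
    b * w 1%N = x * w 0%N ->
    (forall t, b * w t.+2 + c * w t = x * w t.+1) ->
    w N = 0 ->
  toeplitz (N * k) k a b c *m strided _ (N * k) k p w =
    (a + x) *: strided _ (N * k) k p w.
Proof.
move=> k_gt0 w1 wS wN; apply/colP => i.
pose g j := if (j %% k == p)%N then w (j %/ k)%N else 0.
rewrite (toeplitz_mul_col _ _ _ a b c g i k_gt0) !mxE -/(g i).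
(* The last [k] rows miss the term in [b], which would be [b * w N = 0]. *)
have -> : (if (i + k < N * k)%N then g (i + k)%N else 0) = g (i + k)%N.
  case: ltnP => // ink; rewrite /g.
  have -> : ((i + k) %/ k = N)%N.
    apply/eqP; rewrite eqn_leq leq_divRL // ink andbT.
    by rewrite divnDr // divnn k_gt0 addn1 ltn_divLR.
  by rewrite wN; case: ifP.
rewrite /g modnDr divnDr // divnn k_gt0 addn1.
case: ifP => ip; last first.
  case: (leqP k i) => ki; last by rewrite !mulr0 !addr0.
  by rewrite -(modnDr (i - k)) subnK // ip !mulr0 !addr0.
case: (leqP k i) => ki; last by rewrite divn_small // w1; ring.
rewrite -(modnDr (i - k)) subnK // ip.
have -> : (i %/ k = ((i - k) %/ k).+1)%N.
  by rewrite -[in LHS](subnK ki) divnDr // divnn k_gt0 addn1.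
by rewrite mulrDl -wS addrA.
Qed.

(** For [mu ^ 2 = c / b], [mu * b] is one of the two square roots of [b * c];
    which one depends on the choice of [mu]. *)
Lemma toeplitz_chebyshev (F : comNzRingType) (N k p : nat) (a b c mu x : F) :
    (0 < k)%N -> c = mu ^+ 2 * b -> (chebyshevU F N).[x] = 0 ->
  let v := strided F (N * k) k p (fun t => mu ^+ t * (chebyshevU F t).[x]) in
  toeplitz (N * k) k a b c *m v = (a + 2%:R * (mu * b) * x) *: v.
Proof.
move=> k_gt0 -> UN0; apply: toeplitz_strided => //.
- by rewrite hornerC hornerZ hornerX; ring.
- move=> t; rewrite chebyshevU_recE hornerD hornerN hornerM hornerZ hornerX !exprS.
  by move: (chebyshevU F t.+1).[x] (chebyshevU F t).[x] (mu ^+ t) => u v z; ring.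
- by rewrite UN0 mulr0.
Qed.

(** * Linear independence *)

(** A linear combination of evaluations that kills one polynomial of each degree
    below [N] kills every polynomial of degree below [N]. *)
Lemma sum_horner_eq0 (F : fieldType) (I : finType) (C : pred I) (u x : I -> F)
    (p : nat -> {poly F}) (N : nat) (size_p : forall t, size (p t) = t.+1) :
    (forall t, (t < N)%N -> \sum_(i | C i) u i * (p t).[x i] = 0) ->
  forall q : {poly F}, (size q <= N)%N -> \sum_(i | C i) u i * q.[x i] = 0.
Proof.
elim: N => [|m IHm] p0 q sq.
  move: sq; rewrite leqn0 size_poly_eq0 => /eqP->.
  by apply: big1 => i _; rewrite horner0 mulr0.
have p0m t (tm : (t < m)%N) := p0 t (ltnW tm).
(* Subtracting [d *: p m] cancels the coefficient of degree [m] of [q]. *)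
pose d := q`_m / (p m)`_m.
have pm0 : (p m)`_m != 0.
  have -> : (p m)`_m = lead_coef (p m) by rewrite lead_coefE size_p.
  by rewrite lead_coef_eq0 -size_poly_eq0 size_p.
rewrite -(subrK (d *: p m) q).
rewrite (eq_bigr (fun i =>
  u i * (q - d *: p m).[x i] + d * (u i * (p m).[x i]))); last first.
  by move=> i _; rewrite [in LHS]hornerD [in LHS]hornerZ mulrDr mulrCA.
rewrite big_split /= -mulr_sumr p0 // mulr0 addr0; apply: (IHm p0m).
apply/leq_sizeP => j; rewrite coefB coefZ leq_eqVlt => /predU1P[<-|mj].
  by rewrite /d mulfVK ?subrr.
by rewrite !nth_default ?mulr0 ?subr0 ?size_p // (leq_trans sq).
Qed.

(** Column [j] is attached to the residue [j %% k] and to the point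
    [x (j %/ k)]. *)
Lemma strided_basis (F : fieldType) (N k : nat) (mu : F) (p : nat -> {poly F})
    (x : nat -> F) (size_p : forall t, size (p t) = t.+1) :
    (0 < k)%N -> mu != 0 -> {in gtn N &, injective x} ->
  basis_of fullv [tuple strided F (N * k) k (j %% k)
    (fun t => mu ^+ t * (p t).[x (j %/ k)%N]) | j < N * k].
Proof.
move=> k_gt0 mu0 x_inj; rewrite basisEfree subvf dimvf dim_matrix mulr1.
rewrite size_tuple leqnn !andbT; apply/freeP => u u0 j0.
have kN (j : 'I_(N * k)) : (j %/ k < N)%N by rewrite ltn_divLR.
pose C := [pred j : 'I_(N * k) | j %% k == j0 %% k]%N.
(* Row [t * k + j0 %% k] of the relation only involves the columns of the class
   of [j0], and gives the relation between the values of [p t]. *)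
have pC t (tN : (t < N)%N) : \sum_(j | C j) u j * (p t).[x (j %/ k)%N] = 0.
  have iN : (t * k + j0 %% k < N * k)%N.
    by rewrite (leq_trans _ (leq_mul tN (leqnn k))) // mulSnr ltn_add2l ltn_mod.
  have := congr1 (fun v : 'cV_(N * k) => v (Ordinal iN) 0) u0.
  rewrite summxE mxE => E.
  apply: (mulfI (expf_neq0 t mu0)); rewrite mulr0 -[RHS]E mulr_sumr.
  rewrite [RHS](bigID C) /= [X in _ = _ + X]big1 ?addr0; last first.
    move=> j; rewrite eq_sym => jC; rewrite nth_mktuple !mxE /=.
    by rewrite modnMDl modn_mod (negPf jC) mulr0.
  apply: eq_bigr => j /eqP jC; rewrite nth_mktuple !mxE /=.
  rewrite modnMDl modn_mod jC eqxx divnMDl // (divn_small (ltn_pmod j0 k_gt0)).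
  by rewrite addn0 mulrCA.
(* [q] vanishes at all the points but the one attached to [j0]. *)
pose q := \prod_(r <- [seq r <- iota 0 N | r != j0 %/ k]%N) ('X - (x r)%:P).
have sq : (size q <= N)%N.
  rewrite size_prod_XsubC size_filter -[X in (_ <= X)%N](size_iota 0).
  rewrite -(count_predC (pred1 (j0 %/ k)%N)) -[X in (X <= _)%N]add1n leq_add2r.
  by rewrite -has_count has_pred1 mem_iota kN.
have qE (r : nat) : (r < N)%N -> (q.[x r] == 0) = (r != j0 %/ k)%N.
  move=> rN; rewrite -[LHS]/(root q (x r)) /q.
  rewrite -(big_map x predT (fun z => 'X - z%:P)) root_prod_XsubC; apply/mapP/idP => [[r']|r0].
    rewrite mem_filter mem_iota add0n => /and3P[r'0 _ r'N].
    by move=> /x_inj ->.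
  by exists r => //; rewrite mem_filter mem_iota r0.
have := @sum_horner_eq0 F _ C u (fun j => x (j %/ k)%N) p N size_p pC q sq.
rewrite (bigD1 j0) //= big1 ?addr0.
  by move/eqP; rewrite mulf_eq0 qE // eqxx orbF => /eqP.
move=> j /andP[/eqP jC jj0]; apply/eqP; rewrite mulf_eq0 qE //.
apply/orP; right; apply: contraNneq jj0 => jk.
by apply/eqP/val_inj; rewrite /= (divn_eq j k) jC jk -divn_eq.
Qed.

(** * Eigenvalues and eigenvectors of the theorem *)

Lemma lambdaE (R : realType) (N k r : nat) (a : R) (rbc : R[i]) : (0 < k)%N ->
  lambda (N * k) k a rbc r = a%:C + 2%:R * rbc * (cheb_root R N r)%:C.
Proof.
move=> k_gt0; have k0 : k%:R != 0 :> R by rewrite pnatr_eq0 -lt0n.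
have N0 : N.+1%:R != 0 :> R by rewrite pnatr_eq0.
rewrite /lambda /cheb_root rmorphN mulrN -mulSnr !natrM.
congr (_ - _ * (cos _)%:C).
by field; rewrite nat1r N0 k0.
Qed.

Lemma alphaE (R : realType) (N k r : nat) (a : R) (rbc : R[i]) :
    (0 < k)%N -> rbc != 0 ->
  alpha (N * k) k a rbc r = (cheb_root R N r)%:C.
Proof.
move=> k_gt0 rbc0.
by rewrite /alpha lambdaE // addrAC subrr add0r mulrAC divff ?mul1r // mulf_neq0
   ?pnatr_eq0.
Qed.

Lemma index_of_succ (k j : nat) : (0 < k)%N -> index_of k j.+1 = (j %/ k).+1.
Proof.
by move=> k_gt0; rewrite [in LHS](divn_eq j k) addnC -addSn index_ofE ?ltn_mod.
Qed.

(** The vectors of the theorem are numbered from 1, the columns [j] here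
    from 0. *)
Lemma eigvecE (R : realType) (N k j : nat) (a : R) (rbc rmu : R[i]) :
    (0 < k)%N -> rbc != 0 ->
  eigvec (N * k) k a rbc rmu j.+1 =
    strided R[i] (N * k) k (j %% k) (fun t =>
      rmu ^+ t * (chebyshevU R[i] t).[(cheb_root R N (j %/ k).+1)%:C]).
Proof.
move=> k_gt0 rbc0; apply/colP => i; rewrite !mxE /residue /= ltnS subSS.
rewrite index_of_succ // alphaE //.
have -> : ((j %% k <= i) && (k %| i - j %% k))%N = (i %% k == j %% k)%N.
  case: leqP => [ji|ij] /=; first by rewrite -eqn_mod_dvd // modn_mod.
  have ik : (i < k)%N by rewrite (ltn_trans ij) // ltn_mod.
  by rewrite modn_small // ltn_eqF.
case: eqP => // <-.
by have -> : ((i - i %% k) %/ k = i %/ k)%N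
  by rewrite [X in (X - _)%N](divn_eq i k) addnK mulnK.
Qed.

Theorem theorem1 (R : realType) (n k s : nat) (a b c : R) (rbc rmu : R[i])
    (k_ge1 : (1 <= k)%N) (s_ge1 : (1 <= s)%N) (n_def : n = (2 * k * s)%N)
    (b_neq0 : b != 0) (c_neq0 : c != 0)
    (rbc_sqrt : rbc ^+ 2 = (b * c)%:C) (rmu_sqrt : rmu ^+ 2 = (c / b)%:C) :
  let A : 'M[R[i]]_n := toeplitz n k a%:C b%:C c%:C in
  let lam := lambda n k a rbc in
  let P := eigvec n k a rbc rmu in
  [/\ forall x : R[i],
        eigenvalue A x <-> exists2 r, (1 <= r <= n %/ k)%N & x = lam r,
      basis_of fullv [tuple P j.+1 | j < n],
      forall j, (1 <= j <= n)%N ->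
        exists2 r, (1 <= r <= n %/ k)%N & is_eigenvector A (lam r) (P j)
    & rmu * b%:C = rbc ->
      forall j, (1 <= j <= n)%N -> is_eigenvector A (lam (index_of k j)) (P j)].
Proof.
pose N := (2 * s)%N.
have {n_def} nE : n = (N * k)%N by rewrite n_def mulnAC.
subst n => A lam P; rewrite mulnK //.
have rbc0 : rbc != 0.
  by rewrite -sqrf_eq0 rbc_sqrt fmorph_eq0 mulf_neq0.
have rmu0 : rmu != 0.
  by rewrite -sqrf_eq0 rmu_sqrt fmorph_eq0 mulf_neq0 ?invr_eq0.
have mub : (rmu * b%:C == rbc) || (rmu * b%:C == - rbc).
  rewrite -eqf_sqr exprMn rmu_sqrt rbc_sqrt -rmorphXn -rmorphM.
  by apply/eqP; congr (_%:C); field.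
(* The vector of index [r] belongs to the eigenvalue of index [sg r]. *)
pose sg r := if rmu * b%:C == rbc then r else (N.+1 - r)%N.
have sgN r : (1 <= r <= N)%N -> (1 <= sg r <= N)%N.
  rewrite /sg; case: ifP => // _ /andP[r1 rN].
  by rewrite subn_gt0 ltnS rN leq_subLR -add1n leq_add2r.
have sgK r : (1 <= r <= N)%N -> sg (sg r) = r.
  rewrite /sg; case: (rmu * b%:C == rbc) => // /andP[r1 rN].
  by rewrite subKn // leqW.
have lam_sg r : (1 <= r <= N)%N ->
    lam (sg r) = a%:C + 2%:R * (rmu * b%:C) * (cheb_root R N r)%:C.
  move=> /andP[r1 rN]; rewrite /lam lambdaE // /sg.
  case: eqP mub => [-> //|_ /= /eqP->].
  by rewrite cheb_rootC ?leqW // rmorphN !mulrN mulNr.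
have jN j : (j < N * k)%N -> (1 <= (j %/ k).+1 <= N)%N.
  by move=> jn; rewrite /= ltn_divLR.
have eigP j : (j < N * k)%N -> is_eigenvector A (lam (sg (j %/ k).+1)) (P j.+1).
  move=> jn; rewrite /P eigvecE //; split.
    apply: strided_neq0; first by rewrite ltn_mod.
      exact: leq_ltn_trans (leq_mod _ _) jn.
    by rewrite hornerC mulr1 oner_neq0.
  rewrite lam_sg ?jN //; apply: toeplitz_chebyshev => //.
    by rewrite rmu_sqrt -rmorphM mulfVK.
  by rewrite chebyshevU_complex chebyshevU_root ?jN.
have bP : basis_of fullv [tuple P j.+1 | j < N * k].
  have x_inj : {in gtn N &, injective (fun r => (cheb_root R N r.+1)%:C)}.
    move=> r r' rN r'N /complexI E; apply/eq_add_S/(cheb_root_inj R N) => //.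
      by rewrite inE ltnW.
    by rewrite inE ltnW.
  have := strided_basis _ N k rmu _ _ (size_chebyshevU _) k_ge1 rmu0 x_inj.
  by rewrite (_ : mktuple _ = [tuple P j.+1 | j < N * k]) //;
    apply: eq_from_tnth => j; rewrite !tnth_mktuple /P eigvecE.
split=> //.
- move=> x.
  apply: (iff_trans (eigenvalue_eigenbasis _ _ A _
    (fun i => lam (sg (i %/ k).+1)) x bP _)).
    by move=> i; rewrite nth_mktuple; case: (eigP i (ltn_ord i)).
  split=> [[i ->]|[r rN ->]]; first by exists (sg (i %/ k).+1); rewrite ?sgN ?jN.
  (* [lam r] belongs to the vector of index [sg r], in position [1 + (sg r - 1) k]. *)
  have /andP[r1 r2] := sgN r rN.
  have jn : ((sg r).-1 * k < N * k)%N by rewrite ltn_mul2r k_ge1 prednK.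
  by exists (Ordinal jn); rewrite /= mulnK // prednK // sgK.
- by case=> // j jn; exists (sg (j %/ k).+1); [rewrite sgN ?jN | exact: eigP].
- move=> mu_b; case=> // j jn; rewrite index_of_succ //.
  by have := eigP j jn; rewrite /sg mu_b eqxx.
Qed.
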